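(* Let $G=(V,E)$ be a locally finite graph (finite or infinite, not necessarily connected) without a connected component isomorphic to $K_2$, and let $\mathcal{L}=\{L_x\}_{x\in V\cup E}$ be a set of lists of length two for the vertices and edges of $G$. Then $G$ admits a total colouring $c$ with $c(x)\in L_x$ for every $x\in V\cup E$ which breaks every small automorphism of $G$.
   Context: Graphs are simple and undirected, and may be finite or infinite. A graph is locally finite if every vertex has finite degree. An automorphism $\varphi$ of $G$ is small if there is a vertex $v\in V(G)$ such that $\varphi(v)$ is a neighbour of $v$. A list of length two is a set of exactly two colours; lists of different elements may be different. A total colouring of $G$ is a function $c$ assigning a colour to every vertex and every edge of $G$ (not required to be proper). A total colouring $c$ breaks an automorphism $\varphi$ of $G$ if $\varphi$ does not preserve $c$, i.e. there is a vertex $v$ with $c(\varphi(v))\neq c(v)$ or an edge $xy$ with $c(\varphi(x)\varphi(y))\neq c(xy)$. *)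

(* Defs.v *)
(* MathComp world, with the classical sets of MathComp-Analysis. *)
From mathcomp Require Import all_boot all_classical.
From Stdlib Require Import Relation_Operators.

Set Implicit Arguments.
Unset Strict Implicit.
Unset Printing Implicit Defensive.

Local Open Scope classical_set_scope.

Record graph := Graph {
  vertex :> Type;
  adj : vertex -> vertex -> Prop;
  adj_sym : forall x y, adj x y -> adj y x;
  adj_irrefl : forall x, ~ adj x x }.

Definition locally_finite (G : graph) : Prop :=
  forall v : G, finite_set [set w | adj v w].

Definition isomorphic (G H : graph) : Prop :=
  exists f : G -> H, bijective f /\ forall x y, adj x y <-> adj (f x) (f y).

Definition complete_graph (n : nat) : graph :=
  @Graph 'I_n (fun i j => i <> j)
    (fun i j (ij : i <> j) (ji : j = i) => ij (esym ji))
    (fun i (ii : i <> i) => ii erefl).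

Definition induced (G : graph) (A : set G) : graph :=
  @Graph {x : G | A x} (fun x y => adj (sval x) (sval y))
    (fun x y => @adj_sym G (sval x) (sval y))
    (fun x => @adj_irrefl G (sval x)).

Definition component (G : graph) (v : G) : set G :=
  [set w | clos_refl_trans G (@adj G) v w].

(* Edges are the sets {x, y} with x adjacent to y, so that xy and yx are the
   same edge and carry one list and one colour. *)
Definition edge (G : graph) : Type :=
  {e : set G | exists x y : G, adj x y /\ e = [set x; y]}.

Definition mk_edge (G : graph) (x y : G) (xy : adj x y) : edge G :=
  exist _ [set x; y] (ex_intro _ x (ex_intro _ y (conj xy erefl))).

Definition element (G : graph) : Type := (vertex G + edge G)%type.

(* Automorphisms of infinite graphs: bijectivity and preservation of adjacency
   in both directions are both required. *)
Record automorphism (G : graph) := Automorphism {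
  aut_fun :> G -> G;
  aut_bij : bijective aut_fun;
  aut_adj : forall x y, adj x y <-> adj (aut_fun x) (aut_fun y) }.

Definition small (G : graph) (phi : automorphism G) : Prop :=
  exists v : G, adj v (phi v).

Definition edge_image (G : graph) (phi : automorphism G) (x y : G)
    (xy : adj x y) : edge G :=
  mk_edge (proj1 (aut_adj phi x y) xy).

Definition breaks (G : graph) (C : Type) (c : element G -> C)
    (phi : automorphism G) : Prop :=
  (exists v : G, c (inl (phi v)) <> c (inl v)) \/
  (exists (x y : G) (xy : adj x y),
     c (inr (edge_image phi xy)) <> c (inr (mk_edge xy))).

(* Main.v *)
(** Code the colours by integers.  In a connected graph let r maximise the total
    of the larger codes over the vertex itself and its incident edges, give the
    larger code to r, to its edges and to all edges between different layers
    (by distance from r), and colour each layer inductively so that its small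
    automorphisms are broken and every vertex v sees in its layer a smaller code,
    on v or on an edge at v.  Then r is the unique vertex of maximal colour sum,
    so it is fixed, the layers are preserved, and a small automorphism moving
    v <> r to a neighbour restricts to a small automorphism of the layer of v.
    Moreover every vertex sees a larger code (on the edge to the previous layer),
    which, after negating the codes, is the property required of a layer one level
    up.  Layers are finite, and an infinite component is countable, so its colours
    can be coded by nonpositive integers and r still exists. *)
Require Import Defs.
From mathcomp Require Import all_boot all_order all_algebra all_classical.
From mathcomp Require Import zify.

Set Implicit Arguments.
Unset Strict Implicit.
Unset Printing Implicit Defensive.

Import Order.TTheory GRing.Theory Num.Theory.

(* [nb x] lists the closed neighbourhood of x.  A total colouring is a function of
   pairs x, y with [y \in nb x]: the value at (x, x) is the colour of the vertex x,
   the value at (x, y) with x <> y is the colour of the edge xy. *)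
Section ClosedNeighbourhoods.

Variables (T : eqType) (nb : T -> seq T).
Hypothesis nb_uniq : forall x, uniq (nb x).
Hypothesis nb_refl : forall x, x \in nb x.
Hypothesis nb_sym : forall x y, (y \in nb x) = (x \in nb y).

(** * Automorphisms of vertex sets, balls, components and layers *)

Record aut_on (A : set T) (phi : T -> T) : Prop := AutOn {
  aut_on_sub : forall x, A x -> A (phi x);
  aut_on_inj : forall x y, A x -> A y -> phi x = phi y -> x = y;
  aut_on_surj : forall y, A y -> exists2 x, A x & phi x = y;
  aut_on_nb : forall x y, A x -> A y -> (phi y \in nb (phi x)) = (y \in nb x) }.

Definition preserves (C : Type) (A : set T) (c : T -> T -> C) (phi : T -> T) :=
  forall x y, A x -> A y -> y \in nb x -> c (phi x) (phi y) = c x y.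

Definition breaking (C : Type) (A : set T) (c : T -> T -> C) :=
  forall phi, aut_on A phi -> preserves A c phi ->
  forall v, A v -> phi v \in nb v -> phi v = v.

(** As [nb y] contains [y], walks may pause: for [r] in [A] this is a ball, not a sphere, of the
    graph induced on [A]. *)
Fixpoint ball (A : set T) (r : T) (n : nat) : set T :=
  if n is n'.+1 then
    [set x | A x /\ exists2 y, ball A r n' y & x \in nb y]%classic
  else [set r]%classic.

Definition comp (A : set T) (r : T) : set T := [set x | exists n, ball A r n x]%classic.

(** Membership in the same balls encodes equal distance from [r] without a distance function. *)
Definition layer (A : set T) (r x : T) : set T :=
  [set y | A y /\ forall n, ball A r n y <-> ball A r n x]%classic.

Lemma ball_sub A r n x : A r -> ball A r n x -> A x.
Proof. by case: n => [|n] Ar /=; [move=> -> | case]. Qed.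

Lemma comp_refl A r : comp A r r. Proof. by exists 0. Qed.

Lemma comp_sub A r x : A r -> comp A r x -> A x.
Proof. by move=> Ar [n]; apply: ball_sub. Qed.

Lemma comp_nb A r x y : A y -> comp A r x -> y \in nb x -> comp A r y.
Proof. by move=> Ay [n bx] yx; exists n.+1; split => //; exists x. Qed.

Lemma comp_trans A x y z : comp A x y -> comp A y z -> comp A x z.
Proof.
move=> xy [n]; elim: n z => [|n IHn] z /=; first by move=> ->.
by case=> Az [w /IHn xw zw]; apply: comp_nb zw.
Qed.

Lemma comp_sym A x y : A x -> comp A x y -> comp A y x.
Proof.
move=> Ax [n]; elim: n y => [|n IHn] y /=; first by move=> ->; apply: comp_refl.
case=> Ay [z bz yz]; apply: comp_trans (IHn z bz).
by apply: comp_nb (comp_refl A y) _; [apply: ball_sub bz | rewrite nb_sym].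
Qed.

Lemma comp_eq A x y : A x -> comp A x y -> comp A x = comp A y.
Proof.
move=> Ax xy; rewrite predeqE => z; split; apply: comp_trans => //.
exact: comp_sym.
Qed.

Lemma ball_comp A v r n x : comp A v r -> ball A r n x -> ball (comp A v) r n x.
Proof.
move=> vr; elim: n x => [|n IHn] x //= [Ax [y by_ xy]].
split; last by exists y; first exact: IHn.
by apply: comp_nb xy => //; apply: comp_trans vr _; exists n.
Qed.

(** Walks from [v] map to walks from [phi v], which lies in the component. Conversely, a walk from
    [v] pulls back to one from a preimage of [v], and that preimage is [v] or a neighbour of [v]
    because [phi v] is. *)
Lemma aut_on_comp A phi v :
  A v -> aut_on A phi -> phi v \in nb v -> aut_on (comp A v) phi.
Proof.
move=> Av [phiA phi_inj phi_surj phi_nb] phiv.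
have v_phi : comp A v (phi v) by apply: comp_nb phiv; [apply: phiA | apply: comp_refl].
have fwd x : comp A v x -> comp A v (phi x).
  case=> n; elim: n x => [|n IHn] x /=; first by move=> ->.
  case=> Ax [y b_y xy]; have Ay := ball_sub Av b_y.
  by apply: comp_nb (IHn y b_y) _; [apply: phiA | rewrite phi_nb].
have bwd n x : A x -> ball A v n (phi x) -> comp A v x.
  elim: n x => [|n IHn] x Ax /=.
    move=> phix; apply: comp_nb (comp_refl A v) _ => //.
    by rewrite -phi_nb // phix nb_sym.
  case=> _ [y b_y]; have [z Az zy] := phi_surj y (ball_sub Av b_y).
  rewrite -zy phi_nb // => xz.
  by apply: comp_nb xz => //; apply: IHn => //; rewrite zy.
split=> // [x y vx vy|y [n b_y]|x y vx vy].
- by apply: phi_inj; apply: comp_sub; eassumption.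
- have [x Ax xy] := phi_surj y (ball_sub Av b_y).
  by exists x => //; apply: (bwd n) => //; rewrite xy.
- by apply: phi_nb; apply: comp_sub; eassumption.
Qed.

(** * Breaking colourings with a mark at every vertex *)

Local Open Scope ring_scope.

(** The mark [H] is what the induction carries along: in a layer it pushes the weight of each vertex
    below that of the root. Taking [H] to be [setT] drops it. *)
Record marked_breaking (C : Type) (A : set T) (L H : T -> T -> set C) (c : T -> T -> C) :
    Prop := MarkedBreaking {
  mb_list : forall x y, A x -> A y -> y \in nb x -> L x y (c x y);
  mb_sym : forall x y, A x -> A y -> y \in nb x -> c x y = c y x;
  mb_breaking : breaking A c;
  mb_mark : forall v, A v -> exists u, [/\ A u, u \in nb v & H v u (c v u)] }.

(* [lo] and [hi] may be in either order: the induction alternates between them. *)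
Definition good (A : set T) (lo hi c : T -> T -> int) :=
  marked_breaking A (fun x y => [set lo x y; hi x y]%classic)
    (fun x y => [set hi x y]%classic) c.

Lemma good_opp A lo hi c :
  good A lo hi c ->
  good A (fun x y => - lo x y) (fun x y => - hi x y) (fun x y => - c x y).
Proof.
case=> c_list c_sym c_break c_hi; split.
- by move=> x y Ax Ay xy; case: (c_list x y Ax Ay xy) => ->; [left|right].
- by move=> x y Ax Ay xy; rewrite c_sym.
- move=> phi aut pr; apply: c_break => // x y Ax Ay xy.
  exact/oppr_inj/pr.
- by move=> v /c_hi [u [Au uv cE]]; exists u; rewrite cE.
Qed.

(** Layers need the mark on the smaller code. Negation reverses the order, so a mark on the larger
    of the negated codes gives this. *)
Lemma good_swap A lo hi c :
  good A (fun x y => - hi x y) (fun x y => - lo x y) c ->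
  exists c', good A hi lo c'.
Proof.
move=> /good_opp; set hi' := fun _ => _; set lo' := fun _ => _ => cG.
exists (fun x y => - c x y).
have -> : hi = hi' by apply/funext => y; apply/funext => z; rewrite /hi' opprK.
by have -> : lo = lo' by apply/funext => y; apply/funext => z; rewrite /lo' opprK.
Qed.

(** A preserving map that sends [v] to a neighbour restricts to the component of [v], so components
    can be coloured independently. *)
Lemma marked_breaking_of_comp (C : Type) A (L H : T -> T -> set C) (c0 : T -> T -> C) :
  (forall v, A v -> exists c, marked_breaking (comp A v) L H c) ->
  exists c, marked_breaking A L H c.
Proof.
(* Choosing by the set [B], not by a vertex, gives all vertices of a component the same colouring;
   [c0] is a default for other sets. *)
move=> cP; have /choice [col colP] : forall B : set T, exists c,
    forall v, A v -> B = comp A v -> marked_breaking B L H c.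
  move=> B; have [[v [Av ->]]|noB] := pselect (exists v, A v /\ B = comp A v).
    by have [c cG] := cP v Av; exists c.
  by exists c0 => v Av BE; case: noB; exists v.
have cE x y : A x -> A y -> y \in nb x -> comp A y = comp A x.
  by move=> Ax Ay xy; apply/esym/comp_eq => //; apply: comp_nb xy => //; apply: comp_refl.
exists (fun x y => col (comp A x) x y); split.
- move=> x y Ax Ay xy; apply: (mb_list (colP _ x Ax erefl)) => //; first exact: comp_refl.
  by rewrite -(cE x y) //; exact: comp_refl.
- move=> x y Ax Ay xy; rewrite (cE x y) //.
  apply: (mb_sym (colP _ x Ax erefl)) => //; first exact: comp_refl.
  by rewrite -(cE x y) //; exact: comp_refl.
- move=> phi aut pr v Av phiv.
  have autv := aut_on_comp Av aut phiv.
  apply: (mb_breaking (colP _ v Av erefl) autv) => //; last exact: comp_refl.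
  move=> x y vx vy xy.
  have -> : comp A v = comp A x by apply: comp_eq.
  rewrite -(pr x y) //; try by apply: comp_sub; eassumption.
  have <- // : comp A v = comp A (phi x).
    by apply: comp_eq => //; apply: aut_on_sub.
  by have <- // : comp A v = comp A x by apply: comp_eq.
- move=> v Av; have [|u [vu uv uE]] := mb_mark (colP _ v Av erefl) (v := v).
    exact: comp_refl.
  by exists u; split=> //; apply: comp_sub vu.
Qed.

(** * Weights, and the inductive step from the layers to a connected set *)

Definition weight (A : set T) (c : T -> T -> int) (v : T) :=
  \sum_(u <- nb v | `[< A u >]) c v u.

Lemma weight_aut A c phi v :
  aut_on A phi -> preserves A c phi -> A v -> weight A c (phi v) = weight A c v.
Proof.
case=> phiA phi_inj phi_surj phi_nb pr Av.
rewrite /weight -!(big_filter (nb _)).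
have pE : perm_eq [seq phi u | u <- [seq u <- nb v | `[< A u >]]]
                  [seq u <- nb (phi v) | `[< A u >]].
  apply: uniq_perm; rewrite ?filter_uniq //.
    rewrite map_inj_in_uniq ?filter_uniq // => x y.
    by rewrite !mem_filter => /andP[/asboolP Ax _] /andP[/asboolP Ay _]; apply: phi_inj.
  move=> y; rewrite mem_filter; apply/mapP/andP.
    move=> [x]; rewrite mem_filter => /andP[/asboolP Ax xv] ->.
    by split; [apply/asboolP/phiA | rewrite phi_nb].
  move=> [/asboolP /phi_surj [x Ax <-] xv]; exists x => //.
  by rewrite mem_filter -phi_nb // xv andbT; apply/asboolP.
rewrite -(perm_big _ pE) big_map big_filter [RHS]big_filter.
rewrite big_seq_cond [RHS]big_seq_cond.
by apply: eq_bigr => u /andP[uv /asboolP Au]; apply: pr.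
Qed.

Lemma weight_le A c d v :
  (forall u, A u -> u \in nb v -> c v u <= d v u) -> weight A c v <= weight A d v.
Proof.
move=> cd; rewrite /weight big_seq_cond [leRHS]big_seq_cond.
by apply: ler_sum => u /andP[uv /asboolP Au]; apply: cd.
Qed.

Lemma weight_lt A c d v w :
  (forall u, A u -> u \in nb v -> c v u <= d v u) ->
  A w -> w \in nb v -> c v w < d v w -> weight A c v < weight A d v.
Proof.
move=> cd Aw wv lt_w; rewrite /weight -!(big_filter (nb v)).
have wA : w \in [seq u <- nb v | `[< A u >]] by rewrite mem_filter wv andbT; apply/asboolP.
rewrite !(bigD1_seq w) ?filter_uniq //=; apply: ltr_leD => //.
rewrite big_seq_cond [leRHS]big_seq_cond; apply: ler_sum => u /andP[].
by rewrite mem_filter => /andP[/asboolP Au uv] _; apply: cd.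
Qed.

(* The inductive hypothesis on the layers has [lo] and [hi] exchanged. *)
Lemma good_step A r lo hi :
  A r -> (forall x, A x -> comp A r x) ->
  (forall x y, A x -> A y -> y \in nb x -> lo x y < hi x y) ->
  (forall x y, A x -> A y -> y \in nb x -> hi x y = hi y x) ->
  (forall u, A u -> weight A hi u <= weight A hi r) ->
  (forall x, A x -> x <> r -> exists c, good (layer A r x) hi lo c) ->
  exists c, good A lo hi c.
Proof.
move=> Ar Aconn lohi hiC rmax layerP.
have /choice [col colP] : forall B : set T, exists c,
    forall x, A x -> x <> r -> B = layer A r x -> good B hi lo c.
  move=> B; have [[x [Ax xr ->]]|noB] := pselect (exists x, [/\ A x, x <> r & B = layer A r x]).
    by have [c cG] := layerP x Ax xr; exists c.
  by exists lo => x Ax xr BE; case: noB; exists x.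
have layer_refl x : A x -> layer A r x x by [].
have layer_eq x y : layer A r x y -> layer A r y = layer A r x.
  case=> Ay yx; rewrite predeqE => z; split=> -[Az zE]; split=> // n.
    by rewrite zE.
  by rewrite zE yx.
have layer_neq x y : x <> r -> layer A r x y -> y <> r.
  by move=> xr [_ /(_ 0) /= [yrE _]] /yrE.
(* For [x = y] the layer test succeeds, so every vertex except [r] takes its colour from its own
   layer. *)
pose c x y := if [|| x == r, y == r | ~~ `[< layer A r x = layer A r y >]]
              then hi x y else col (layer A r x) x y.
have c_in x u v : x <> r -> layer A r x u -> layer A r x v ->
    c u v = col (layer A r x) u v.
  move=> xr xu xv; rewrite /c (introF eqP (layer_neq _ _ xr xu)).
  rewrite (introF eqP (layer_neq _ _ xr xv)) (layer_eq _ _ xu) (layer_eq _ _ xv).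
  by rewrite asboolT.
have colG x : A x -> x <> r -> good (layer A r x) hi lo (col (layer A r x)).
  by move=> Ax xr; apply: (colP _ x).
have c_spec x y : A x -> A y -> y \in nb x ->
    (c x y = hi x y /\ c y x = hi y x) \/
    [/\ x <> r, layer A r x y & c x y = col (layer A r x) x y].
  move=> Ax Ay xy; have [-> | /eqP xr] := eqVneq x r.
    by left; rewrite /c eqxx orbT.
  have [-> | /eqP yr] := eqVneq y r; first by left; rewrite /c eqxx orbT.
  have [xyE|xyN] := pselect (layer A r x = layer A r y).
    have lxy : layer A r x y by rewrite xyE; apply: layer_refl.
    by right; split=> //; apply: c_in => //; apply: layer_refl.
  left; rewrite /c !asboolF ?orbT //.
  by move=> yxE; apply: xyN.
have c_list x y : A x -> A y -> y \in nb x -> c x y = lo x y \/ c x y = hi x y.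
  move=> Ax Ay xy; case: (c_spec x y) => // [[-> _]|[xr lxy ->]]; first by right.
  by case: (mb_list (colG x Ax xr) _ lxy xy) => [|->|->];
    [apply: layer_refl | right | left].
have c_le x y : A x -> A y -> y \in nb x -> c x y <= hi x y.
  by move=> Ax Ay xy; case: (c_list x y) => // ->; first exact/ltW/lohi.
have weight_r : weight A c r = weight A hi r.
  by apply: eq_bigr => u _; rewrite /c eqxx.
(* The mark of the layer colouring puts [lo] on one summand at [u], while all summands at [r] equal
   [hi]. *)
have weight_lt_r u : A u -> u <> r -> weight A c u < weight A c r.
  move=> Au ur; rewrite weight_r; apply: lt_le_trans (rmax u Au).
  have [w [uw wu wE]] := mb_mark (colG u Au ur) (layer_refl u Au).
  have Aw : A w by case: uw.
  apply: (weight_lt _ Aw wu); first by move=> x Ax xu; apply: c_le.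
  by rewrite (c_in u) // ?wE; apply: lohi.
exists c; split=> //.
- move=> x y Ax Ay xy; case: (c_spec x y) => // [[-> ->]|[xr lxy ->]]; first exact: hiC.
  rewrite (c_in x) //.
  by apply: (mb_sym (colG x Ax xr)) => //; apply: layer_refl.
- move=> phi aut pr v Av phiv.
  have phi_r : phi r = r.
    apply/eqP/negPn/negP => /eqP phir.
    have := weight_lt_r _ (aut_on_sub aut Ar) phir.
    by rewrite (weight_aut aut pr) // ltxx.
  have [-> // | /eqP vr] := eqVneq v r.
  (* As [phi] fixes [r], it permutes every ball around [r], hence every layer. *)
  have ballE n x : A x -> ball A r n (phi x) <-> ball A r n x.
    elim: n x => [|n IHn] x Ax /=.
      split=> [|->//]; rewrite -{1}phi_r; exact: (aut_on_inj aut).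
    split=> -[_ [y b_y xy]].
      have [z Az zy] := aut_on_surj aut (ball_sub Ar b_y).
      split=> //; exists z; first by apply/IHn => //; rewrite zy.
      by rewrite -(aut_on_nb aut) // zy.
    have Ay := ball_sub Ar b_y.
    split; first exact: (aut_on_sub aut).
    by exists (phi y); [apply/IHn | rewrite (aut_on_nb aut)].
  have lphi x : layer A r v x -> layer A r v (phi x).
    by case=> Ax xv; split=> [|n]; [apply: (aut_on_sub aut) | rewrite ballE].
  apply: (mb_breaking (colG v Av vr) (phi := phi)) => //.
    split=> // [x y [Ax _] [Ay _]|y [Ay yv]|x y [Ax _] [Ay _]].
    + exact: (aut_on_inj aut).
    + have [x Ax xy] := aut_on_surj aut Ay; exists x => //.
      by split=> // n; rewrite -yv -xy ballE.
    + exact: (aut_on_nb aut).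
  move=> x y vx vy xy; rewrite -!c_in //; try exact: lphi.
  by apply: pr => //; [case: vx | case: vy].
- move=> v Av; have [->|/eqP vr] := eqVneq v r.
    by exists r; split=> //; rewrite /c eqxx.
  have hasb : exists n, `[< ball A r n v >].
    by have [n b_v] := Aconn v Av; exists n; apply/asboolP.
  (* The least ball containing [v] has positive radius. The predecessor [u] of [v] lies in a smaller
     ball, hence in another layer, so the edge between them has colour [hi]. *)
  case: (ex_minnP hasb) => -[|n] /asboolP /=; first by move=> /vr.
  case=> _ [u b_u vu] nmin; exists u; split.
  + exact: ball_sub b_u.
  + by rewrite nb_sym.
  + rewrite /c asboolF ?orbT // => lE.
    have [_ /(_ n) [_ /(_ b_u) b_v]] : layer A r u v by rewrite -lE; apply: layer_refl.
    by have /asboolP /nmin := b_v; rewrite ltnn.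
Qed.

(** * Existence on finite sets, on connected sets, and for arbitrary colours *)

Lemma exists_max_seq (A : set T) (F : T -> int) (s : seq T) :
  (forall x, A x -> x \in s) -> (exists x, A x) ->
  exists2 r, A r & forall x, A x -> F x <= F r.
Proof.
elim: s A => [|a s IHs] A As [x Ax]; first by have := As x Ax.
have [[y [Ay ya]]|noy] := pselect (exists y, A y /\ y <> a); last first.
  have allA z : A z -> z = a.
    by move=> Az; apply: contrapT => za; apply: noy; exists z.
  by exists x => // z /allA ->; rewrite -(allA x Ax).
have [||r [Ar ra] rmax] := IHs (fun z => A z /\ z <> a).
- by move=> z [/As]; rewrite inE => /predU1P[].
- by exists y.
have [Aa|nAa] := pselect (A a); last first.
  by exists r => // z Az; apply: rmax; split=> // za; apply: nAa; rewrite -za.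
have [le_ar|lt_ra] := leP (F a) (F r).
  exists r => // z Az; have [->//|/eqP za] := eqVneq z a.
  exact: rmax.
exists a => // z Az; have [->//|/eqP za] := eqVneq z a.
by apply: le_trans (rmax z _) (ltW lt_ra).
Qed.

(** Layers avoid [r], so they fit into the shorter list [rem r s]; as they may be disconnected, each
    round first splits into components. *)
Lemma finite_good (s : seq T) (A : set T) lo hi :
  (forall x, A x -> x \in s) ->
  (forall x y, A x -> A y -> y \in nb x -> lo x y < hi x y) ->
  (forall x y, A x -> A y -> y \in nb x -> lo x y = lo y x) ->
  (forall x y, A x -> A y -> y \in nb x -> hi x y = hi y x) ->
  exists c, good A lo hi c.
Proof.
have [n] := ubnP (size s); elim: n s A lo hi => // n IHn s A lo hi s_n As lohi loC hiC.
apply: (marked_breaking_of_comp lo) => v Av.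
have KA x : comp A v x -> A x by apply: comp_sub.
have [|r Kr rmax] := @exists_max_seq (comp A v) (weight (comp A v) hi) s _
  (ex_intro _ v (comp_refl A v)).
  by move=> x /KA /As.
have rs : r \in s by apply/As/KA.
apply: (good_step Kr) => //; try by move=> x y /KA Ax /KA Ay; auto.
  move=> x Kx; have [m b_x] : comp A r x.
    by apply: comp_trans Kx; apply: comp_sym.
  by exists m; apply: ball_comp.
move=> x Kx xr.
have lA y : layer (comp A v) r x y -> A y by case=> /KA.
have [|||||c cG] := IHn (rem r s) (layer (comp A v) r x)
  (fun x y => - hi x y) (fun x y => - lo x y).
- rewrite size_rem //; case: (s) rs s_n => //= a s' _; exact.
- move=> y yl; have yr : y != r.
    by apply/eqP => yE; case: yl => _ /(_ 0) /= [xE _]; apply: xr; rewrite xE.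
  by have := As y (lA y yl); rewrite (perm_mem (perm_to_rem rs)) inE (negbTE yr).
- by move=> y z /lA Ay /lA Az yz; rewrite ltrN2 lohi.
- by move=> y z /lA Ay /lA Az yz; rewrite hiC.
- by move=> y z /lA Ay /lA Az yz; rewrite loC.
exact/good_swap/cG.
Qed.

Lemma ball_finite A r n : finite_set (ball A r n).
Proof.
elim: n => [|n IHn] /=; first exact: finite_set1.
apply: (@sub_finite_set _ _ (\bigcup_(y in ball A r n) [set` nb y])%classic).
  by move=> x [_ [y b_y xy]]; exists y.
by apply: bigcup_finite => // y _; apply: finite_seq.
Qed.

(** Nonpositive codes give nonpositive integer weights, so a maximum exists even on an infinite set.
    Each layer lies in a finite ball, where [finite_good] applies. *)
Lemma connected_good A r lo hi :
  A r -> (forall x, A x -> comp A r x) ->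
  (forall x y, A x -> A y -> y \in nb x -> lo x y < hi x y) ->
  (forall x y, A x -> A y -> y \in nb x -> hi x y <= 0) ->
  (forall x y, A x -> A y -> y \in nb x -> lo x y = lo y x) ->
  (forall x y, A x -> A y -> y \in nb x -> hi x y = hi y x) ->
  exists c, good A lo hi c.
Proof.
move=> Ar Aconn lohi hi0 loC hiC.
have wt0 u : A u -> weight A hi u <= 0.
  move=> Au; rewrite /weight big_seq_cond; apply: sumr_le0 => w /andP[wu /asboolP Aw].
  exact: hi0.
(* The least absolute value of a weight belongs to a vertex of maximal weight. *)
pose P n := `[< exists2 u, A u & weight A hi u = - n%:Z >].
have Pex : exists n, P n.
  exists `|weight A hi r|%N; apply/asboolP; exists r => //.
  by rewrite abszE ler0_norm ?opprK ?wt0.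
case: (ex_minnP Pex) => m /asboolP[q Aq qm] mmin.
have qmax u : A u -> weight A hi u <= weight A hi q.
  move=> Au; have /mmin : P `|weight A hi u|%N.
    by apply/asboolP; exists u => //; rewrite abszE ler0_norm ?opprK ?wt0.
  rewrite qm -lez_nat abszE ler0_norm ?wt0 // => le_m.
  by rewrite lerNr.
have Aconnq x : A x -> comp A q x.
  by move=> Ax; apply: comp_trans (Aconn x Ax); apply: comp_sym => //; apply: Aconn.
apply: (good_step Aq) => // x Ax xq.
have [n b_x] := Aconnq x Ax.
have /finite_seqP[s sE] := ball_finite A q n.
have lA y : layer A q x y -> A y by case.
have [|||| c cG] := @finite_good s (layer A q x) (fun x y => - hi x y) (fun x y => - lo x y).
- move=> y [_ /(_ n) [_ /(_ b_x)]]; by rewrite sE.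
- by move=> y z /lA Ay /lA Az yz; rewrite ltrN2 lohi.
- by move=> y z /lA Ay /lA Az yz; rewrite hiC.
- by move=> y z /lA Ay /lA Az yz; rewrite loC.
exact/good_swap/cG.
Qed.

(** A component is a countable union of finite balls, so its colours inject into the naturals and
    [connected_good] applies. *)
Lemma exists_breaking (C : Type) (A : set T) (la lb : T -> T -> C) :
  (forall x y, A x -> A y -> y \in nb x -> la x y <> lb x y) ->
  (forall x y, A x -> A y -> y \in nb x -> la x y = la y x) ->
  (forall x y, A x -> A y -> y \in nb x -> lb x y = lb y x) ->
  exists c, [/\ forall x y, A x -> A y -> y \in nb x -> c x y = la x y \/ c x y = lb x y,
    forall x y, A x -> A y -> y \in nb x -> c x y = c y x & breaking A c].
Proof.
move=> lab laC lbC.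
suff [c [c_list c_sym c_break _]] : exists c, marked_breaking A
    (fun x y => [set la x y; lb x y]%classic) (fun _ _ => setT) c by exists c; split.
apply: (marked_breaking_of_comp la) => v Av; set K := comp A v.
have KA x : K x -> A x by apply: comp_sub.
have cntK : countable K.
  apply: (@sub_countable _ _ _ (\bigcup_n ball A v n)%classic).
    by apply/subset_card_le => x [n b_x]; exists n.
  by apply: bigcup_countable => // n _; apply/finite_set_countable/ball_finite.
pose colours := (\bigcup_(x in K) \bigcup_(y in [set` nb x]) [set la x y; lb x y])%classic.
have [code code_inj] : exists code : C -> nat, {in colours &, injective code}.
  apply/pcard_injP; apply: bigcup_countable => // x _.
  apply: finite_set_countable; apply: bigcup_finite; first exact: finite_seq.
  by move=> y _; apply: finite_set2.
have codeN x y : K x -> K y -> y \in nb x -> code (la x y) <> code (lb x y).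
  move=> Kx Ky xy /code_inj codeE; apply: (lab x y) => //; [exact: KA | exact: KA |].
  by apply: codeE; apply/mem_set; exists x => //; exists y => //; [left | right].
have laKC x y : K x -> K y -> y \in nb x -> la x y = la y x.
  by move=> /KA Ax /KA Ay; apply: laC.
have lbKC x y : K x -> K y -> y \in nb x -> lb x y = lb y x.
  by move=> /KA Ax /KA Ay; apply: lbC.
(* The two codes differ, and negating the larger one gives the smaller integer: [lo < hi <= 0]. *)
pose lo x y : int := - (maxn (code (la x y)) (code (lb x y)))%:Z.
pose hi x y : int := - (minn (code (la x y)) (code (lb x y)))%:Z.
have [|x y Kx Ky xy|x y _ _ _|x y Kx Ky xy|x y Kx Ky xy|c [c_list c_sym c_break _]] :=
    @connected_good K v lo hi (comp_refl A v).
- by move=> x Kx; case: (Kx) => n; exists n; apply: ball_comp => //; apply: comp_refl.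
- by have := codeN x y Kx Ky xy; rewrite /lo /hi ltrN2 ltz_nat; lia.
- by rewrite /hi oppr_le0.
- by rewrite /lo laKC // lbKC.
- by rewrite /hi laKC // lbKC.
(* Decoding: a value other than minus the code of [la] must be minus the code of [lb]. *)
pose d x y := if c x y == - (code (la x y))%:Z then la x y else lb x y.
have codeE x y : K x -> K y -> y \in nb x -> c x y = - (code (d x y))%:Z.
  move=> Kx Ky xy; rewrite /d; case: eqP => // cN.
  by case: (c_list x y Kx Ky xy) cN => /= ->; rewrite /lo /hi => cN; lia.
exists d; split=> [x y|x y Kx Ky xy|phi aut pr|u Ku].
- by rewrite /d; case: ifP; [left | right].
- by rewrite /d c_sym // laKC // lbKC.
- apply: c_break => // x y Kx Ky xy; rewrite !codeE ?pr //.
  + exact: (aut_on_sub aut).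
  + exact: (aut_on_sub aut).
  + by rewrite (aut_on_nb aut).
- by exists u; split.
Qed.

End ClosedNeighbourhoods.

(** * Transfer to graphs *)

Local Open Scope classical_set_scope.
Local Open Scope card_scope.

Lemma card_eq2 (T : Type) (A : set T) :
  A #= `I_2 -> exists p : T * T, [/\ A p.1, A p.2 & p.1 <> p.2].
Proof.
move=> /eq_cardSP[a Aa /eq_cardSP[b [Ab ba] _]].
by exists (a, b); split=> //= ab; apply: ba.
Qed.

Lemma mk_edgeC (G : graph) (x y : G) (xy : adj x y) (yx : adj y x) :
  mk_edge xy = mk_edge yx.
Proof. by apply: eq_exist; rewrite setUC. Qed.

Lemma mk_edge_irr (G : graph) (x y : G) (xy xy' : adj x y) : mk_edge xy = mk_edge xy'.
Proof. exact: eq_exist. Qed.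

Lemma edgeP (G : graph) (e : edge G) : exists p : G * G, exists xy : adj p.1 p.2, e = mk_edge xy.
Proof.
by case: e => e [x [y [xy eE]]]; exists (x, y), xy; apply: eq_exist.
Qed.

Lemma mk_edge_inj (G : graph) (x y x' y' : G) (xy : adj x y) (xy' : adj x' y') :
  mk_edge xy = mk_edge xy' -> (x = x' /\ y = y') \/ (x = y' /\ y = x').
Proof.
move=> /(f_equal sval) /= E.
have x_in : [set x'; y'] x by rewrite -E; left.
have y_in : [set x'; y'] y by rewrite -E; right.
case: x_in y_in => /= [xx'|xy'E] [yx'|yy'E].
- by case: (@adj_irrefl G x); rewrite {2}xx' -yx'.
- by left.
- by right.
- by case: (@adj_irrefl G x); rewrite {2}xy'E -yy'E.
Qed.

Theorem theorem3 (G : graph) (C : Type) (L : element G -> set C)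
    (G_lf : locally_finite G)
    (G_noK2 : forall v : G, ~ isomorphic (induced (component v)) (complete_graph 2))
    (L_two : forall x : element G, L x #= `I_2) :
  exists c : element G -> C,
    (forall x : element G, L x (c x)) /\
    (forall phi : automorphism G, small phi -> breaks c phi).
Proof.
(* The classical choice type supplies the decidable equality that neighbour lists require. *)
pose T : choiceType := {classic vertex G}.
have /choice[nbr nbrP] : forall x : T, exists s : seq T, [set w : T | adj x w] = [set` s].
  by move=> x; apply/finite_seqP/(G_lf x).
pose nb (x : T) := undup (x :: nbr x).
have nbE x y : (y \in nb x) = (y == x) || `[< adj x y >].
  rewrite mem_undup inE; congr (_ || _).
  have -> : adj x y = (y \in nbr x) :> Prop.
    exact: (congr1 (fun A : set T => A y) (nbrP x)).
  by rewrite asboolb.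
have /choice[two twoP] := fun x => card_eq2 (L_two x).
(* For x, y distinct and not adjacent, [el x y] is a junk value. *)
pose el (x y : T) : element G :=
  if pselect (adj x y) is left xy then inr (mk_edge xy) else inl x.
have elC x y : y \in nb x -> el x y = el y x.
  rewrite nbE => /predU1P[-> //|/asboolP xy]; rewrite /el.
  case: pselect => // xy1; case: pselect => [yx|[]]; last exact: adj_sym.
  by congr inr; apply: mk_edgeC.
have nb_refl x : x \in nb x by rewrite nbE eqxx.
have nb_sym x y : (y \in nb x) = (x \in nb y).
  by rewrite !nbE eq_sym; congr (_ || _); apply/asboolP/asboolP; apply: adj_sym.
have [|x y _ _ xy|x y _ _ xy|c [c_list c_sym c_break]] :=
  @exists_breaking T nb (fun x => undup_uniq _) nb_refl nb_sym C setT
    (fun x y => (two (el x y)).1) (fun x y => (two (el x y)).2).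
- by move=> x y _ _ _; case: (twoP (el x y)).
- by rewrite elC.
- by rewrite elC.
have cL (x y : T) : y \in nb x -> L (el x y) (c x y).
  move=> xy; have [La Lb _] := twoP (el x y).
  by case: (c_list x y I I xy) => ->.
have /choice[ends endsP] := @edgeP G.
(* [ends] orients each edge arbitrarily; the symmetry of [c] makes the orientation harmless. *)
pose d (z : element G) := match z with inl v => c v v | inr e => c (ends e).1 (ends e).2 end.
have d_edge x y (xy : adj x y) : d (inr (mk_edge xy)) = c x y.
  rewrite /d; case: (endsP (mk_edge xy)) => xy' /mk_edge_inj[[<- <-] //|[<- <-]].
  by apply: c_sym => //; rewrite nbE; apply/orP; right; apply/asboolP/adj_sym.
exists d; split=> [[v|e]|phi [v vphi]].
- have := cL v v; rewrite /el; case: pselect => [/adj_irrefl //|_]; exact.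
- have [xy ->] := endsP e; rewrite d_edge.
  have := cL (ends e).1 (ends e).2; rewrite /el; case: pselect => // xy1.
  rewrite (mk_edge_irr xy xy1); apply.
  by rewrite nbE; apply/orP; right; apply/asboolP.
(* An unbroken [phi] preserves [c] and so fixes [v], contradicting that [phi v] is adjacent to
   [v]. *)
- apply: contrapT => nbreak.
  have phiK : phi v = v.
    apply: (c_break phi) => //; last first.
    + by rewrite nbE; apply/orP; right; apply/asboolP.
    + move=> x y _ _; rewrite nbE => /predU1P[->|/asboolP xy].
        by apply: contrapT => neq; apply: nbreak; left; exists x.
      apply: contrapT => neq; apply: nbreak; right; exists x, y, xy.
      by rewrite /edge_image !d_edge.
    + have phi_inj := bij_inj (aut_bij phi); have [psi _ psiK] := aut_bij phi.
      split=> // [x y _ _ /phi_inj //|y _|x y _ _].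
        by exists (psi y).
      rewrite !nbE; congr (_ || _); first by apply/eqP/eqP => [/phi_inj|->].
      by apply: asbool_equiv_eq; apply: iff_sym; apply: (aut_adj phi).
  by move: vphi; rewrite phiK => /adj_irrefl.
Qed.
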